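(* Let $\Gamma=\langle\mathcal{A},\mathcal{R}\rangle$ be an AFRA which is an AF, i.e. $\mathcal{R}\subseteq\mathcal{A}\times\mathcal{A}$, and let $\mathcal{S}\subseteq\mathcal{A}\cup\mathcal{R}$. Then $\mathcal{S}$ is a complete extension of $\Gamma$ if and only if $\mathcal{S}=\mathcal{U}^{\rightarrow AFRA}$ for some $\mathcal{U}\subseteq\mathcal{A}$ which is a D-complete extension of $\Gamma$.
   Context: An AFRA (Argumentation Framework with Recursive Attacks) is a pair $\langle\mathcal{A},\mathcal{R}\rangle$ where $\mathcal{A}$ is a set (of arguments) and $\mathcal{R}$ is a set of attacks, each attack being a pair $\alpha=(A,X)$ with $A\in\mathcal{A}$ and ($X\in\mathcal{R}$ or $X\in\mathcal{A}$); $A=src(\alpha)$ is its source and $X=trg(\alpha)$ its target. Arguments and attacks are distinct objects ($\mathcal{A}\cap\mathcal{R}=\emptyset$). Defeat: for $\alpha\in\mathcal{R}$, $V\in\mathcal{A}\cup\mathcal{R}$, $\alpha$ directly defeats $V$ iff $V=trg(\alpha)$; $\alpha$ indirectly defeats $\beta\in\mathcal{R}$ iff $\alpha$ directly defeats $src(\beta)$; $\alpha\rightarrow_R V$ ($\alpha$ defeats $V$) iff $\alpha$ directly or indirectly defeats $V$. Only attacks can defeat. A set $\mathcal{S}\subseteq\mathcal{A}\cup\mathcal{R}$ is conflict-free iff there are no $V,W\in\mathcal{S}$ with $V\rightarrow_R W$. $W\in\mathcal{A}\cup\mathcal{R}$ is acceptable w.r.t. $\mathcal{S}$ iff for every $\alpha\in\mathcal{R}$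 with $\alpha\rightarrow_R W$ there is $\beta\in\mathcal{S}$ with $\beta\rightarrow_R\alpha$. $\mathcal{S}$ is admissible iff it is conflict-free and each of its elements is acceptable w.r.t. $\mathcal{S}$. $\mathcal{S}$ is a complete extension iff it is admissible and every element of $\mathcal{A}\cup\mathcal{R}$ acceptable w.r.t. $\mathcal{S}$ belongs to $\mathcal{S}$. Dung notions (for $\Gamma$ viewed as a Dung argumentation framework with set of arguments $\mathcal{A}$ and attack relation $\mathcal{R}\subseteq\mathcal{A}\times\mathcal{A}$): $\mathcal{U}\subseteq\mathcal{A}$ is D-conflict-free if there are no $A,B\in\mathcal{U}$ with $(A,B)\in\mathcal{R}$; $A\in\mathcal{A}$ is D-acceptable w.r.t. $\mathcal{U}$ if for all $B\in\mathcal{A}$ with $(B,A)\in\mathcal{R}$ there is $C\in\mathcal{U}$ with $(C,B)\in\mathcal{R}$; $\mathcal{U}$ is D-admissible if it is D-conflict-free and each of its elements is D-acceptable w.r.t. $\mathcal{U}$; $\mathcal{U}$ is a D-complete extension if it is D-admissible and contains every argument D-acceptable w.r.t. $\mathcal{U}$. For $\mathcal{U}\subseteq\mathcal{A}$, $\mathcal{U}^{\rightarrow AFRA}:=\mathcal{U}\cup\{\alpha\in\mathcal{R}\mid src(\alpha)\in\mathcal{U}\}$. *)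

(* Defs.v *)
From mathcomp Require Import all_boot.
From mathcomp Require Import boolp classical_sets.

Set Implicit Arguments.
Unset Strict Implicit.
Unset Printing Implicit Defensive.

Local Open Scope classical_set_scope.

(* Argumentation frameworks with recursive attacks over a universe T of
   potential arguments.  An attack is a pair of a source argument and a target,
   the target being an argument or, recursively, an attack.  The two
   constructors keep arguments and attacks disjoint, so no separate disjointness
   hypothesis is needed. *)
Inductive entity (T : Type) : Type :=
| Arg of T
| Att of T * entity T.

Arguments Arg {T} _.
Arguments Att {T} _.

Definition attack (T : Type) : Type := (T * entity T)%type.

Definition src (T : Type) (a : attack T) : T := a.1.
Definition trg (T : Type) (a : attack T) : entity T := a.2.

Definition entities (T : Type) (A : set T) (R : set (attack T)) :
  set (entity T) := (Arg @` A) `|` (Att @` R).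

Record afra (T : Type) : Type := Afra {
  args : set T;
  attacks : set (attack T);
  src_args : forall a, attacks a -> args (src a);
  trg_entities : forall a, attacks a -> entities args attacks (trg a)
}.

Section Afra.
Variables (T : Type) (G : afra T).

Definition elements : set (entity T) := entities (args G) (attacks G).

Definition directly_defeats (a : attack T) (V : entity T) : Prop :=
  [/\ attacks G a, elements V & V = trg a].

Definition indirectly_defeats (a b : attack T) : Prop :=
  attacks G b /\ directly_defeats a (Arg (src b)).

(* Defined between arbitrary entities so that it can be used on members of a
   mixed set of arguments and attacks; only attacks defeat. *)
Definition defeats (V W : entity T) : Prop :=
  exists2 a : attack T, V = Att a &
    directly_defeats a W \/
    (exists2 b : attack T, W = Att b & indirectly_defeats a b).

Definition conflict_free (S : set (entity T)) : Prop :=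
  ~ exists V W, [/\ S V, S W & defeats V W].

Definition acceptable (S : set (entity T)) (W : entity T) : Prop :=
  forall a, attacks G a -> defeats (Att a) W ->
    exists2 V, S V & defeats V (Att a).

Definition admissible (S : set (entity T)) : Prop :=
  conflict_free S /\ (forall W, S W -> acceptable S W).

Definition complete_extension (S : set (entity T)) : Prop :=
  admissible S /\ (forall W, elements W -> acceptable S W -> S W).

Definition is_AF : Prop :=
  forall a, attacks G a -> exists2 B, args G B & trg a = Arg B.

Definition to_AFRA (U : set T) : set (entity T) :=
  (Arg @` U) `|` (Att @` [set a | attacks G a /\ U (src a)]).

End Afra.

Record dung (T : Type) : Type := Dung {
  dargs : set T;
  dattacks : set (T * T);
  dattacks_args : dattacks `<=` dargs `*` dargs
}.

Section Dung.
Variables (T : Type) (D : dung T).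

Definition D_conflict_free (U : set T) : Prop :=
  ~ exists A B, [/\ U A, U B & dattacks D (A, B)].

Definition D_acceptable (U : set T) (A : T) : Prop :=
  forall B, dargs D B -> dattacks D (B, A) ->
    exists2 C, U C & dattacks D (C, B).

Definition D_admissible (U : set T) : Prop :=
  D_conflict_free U /\ (forall A, U A -> D_acceptable U A).

Definition D_complete_extension (U : set T) : Prop :=
  D_admissible U /\ (forall A, dargs D A -> D_acceptable U A -> U A).

End Dung.

Lemma as_dung_subproof (T : Type) (G : afra T) :
  [set p : T * T | attacks G (p.1, Arg p.2)] `<=` args G `*` args G.
Proof.
move=> [A B] /= RAB; split; first exact: (src_args RAB).
by case: (trg_entities RAB) => [[C AC [<-]]|[? _]].
Qed.

(* The arguments of G with its attacks between arguments.  When is_AF G holds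
   these are all the attacks of G, so this is G itself read as a Dung
   framework. *)
Definition as_dung (T : Type) (G : afra T) : dung T :=
  Dung (@as_dung_subproof T G).

(* Main.v *)
(* When every attack targets an argument, an attack is defeated by exactly the
   attacks that defeat its source.  Hence it is acceptable iff its source is, so
   a complete extension is determined by its arguments [U] and equals
   [to_AFRA G U]; on sets of this form the AFRA notions reduce to Dung's. *)
Require Import Defs.
From mathcomp Require Import all_boot.
From mathcomp Require Import boolp classical_sets.

Set Implicit Arguments.
Unset Strict Implicit.

Local Open Scope classical_set_scope.

Lemma elements_Arg (T : Type) (G : afra T) (A : T) :
  elements G (Arg A) <-> args G A.
Proof.
split=> [[[B GB [<-]] //|[b _ //]]|GA].
by left; exists A.
Qed.

Lemma elements_Att (T : Type) (G : afra T) (a : attack T) :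
  elements G (Att a) <-> attacks G a.
Proof.
split=> [[[B _ //]|[b Gb [<-] //]]|Ga].
by right; exists a.
Qed.

Lemma to_AFRA_Arg (T : Type) (G : afra T) (U : set T) (A : T) :
  to_AFRA G U (Arg A) <-> U A.
Proof.
split=> [[[B UB [<-]] //|[b _ //]]|UA].
by left; exists A.
Qed.

Lemma to_AFRA_Att (T : Type) (G : afra T) (U : set T) (a : attack T) :
  to_AFRA G U (Att a) <-> attacks G a /\ U (src a).
Proof.
split=> [[[B _ //]|[b Gb [<-] //]]|Ga].
by right; exists a.
Qed.

(** Indirect defeat only reaches attacks, so an argument can only be defeated by an attack that
    targets it. *)
Lemma defeats_Arg (T : Type) (G : afra T) (V : entity T) (A : T) :
  defeats G V (Arg A) <->
  exists2 B, V = Att (B, Arg A) & attacks G (B, Arg A).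
Proof.
split=> [[[B X] -> [[Ga _ /= eX]|[b //]]]|[B -> Ga]].
  by move: Ga; rewrite -eX => Ga; exists B.
exists (B, Arg A) => //; left; split=> //.
exact: (trg_entities Ga).
Qed.

(** By [is_AF] no attack has an attack as target, so [b] can only be defeated indirectly, which is
    by definition a direct defeat of its source. *)
Lemma defeats_Att (T : Type) (G : afra T) (hG : is_AF G) (V : entity T)
    (b : attack T) (Gb : attacks G b) :
  defeats G V (Att b) <-> defeats G V (Arg (src b)).
Proof.
split=> [[a -> [[Ga _ tb]|[c [<-] [_ ab]]]]|[a -> [ab|[c //]]]].
- by have [B _] := hG _ Ga; rewrite -tb.
- by exists a => //; left.
- by exists a => //; right; exists b.
Qed.

Lemma acceptable_Att (T : Type) (G : afra T) (hG : is_AF G)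
    (S : set (entity T)) (b : attack T) (Gb : attacks G b) :
  acceptable G S (Att b) <-> acceptable G S (Arg (src b)).
Proof.
by split=> accS a Ga ab; apply: accS => //; apply/(defeats_Att hG _ Gb).
Qed.

(** The defeaters of [A] are the attacks [(B, Arg A)]. Such an attack is defeated exactly by the
    attacks [(C, Arg B)] on its source, and these lie in [to_AFRA G U] exactly when [C] is in
    [U]. *)
Lemma acceptable_to_AFRA (T : Type) (G : afra T) (hG : is_AF G) (U : set T)
    (A : T) :
  acceptable G (to_AFRA G U) (Arg A) <-> D_acceptable (as_dung G) U A.
Proof.
split=> [accA B GB /= BA|accA a Ga /defeats_Arg[B [ea] BA]].
  have /(accA _ BA)[V UV] : defeats G (Att (B, Arg A)) (Arg A).
    by apply/defeats_Arg; exists B.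
  move=> /(defeats_Att hG _ BA)/defeats_Arg[C eV CB].
  by move: UV; rewrite eV => /to_AFRA_Att[_ UC]; exists C.
have [C UC CB] := accA B (src_args BA) BA.
exists (Att (C, Arg B)); first by apply/to_AFRA_Att.
by rewrite ea; apply/(defeats_Att hG _ BA)/defeats_Arg; exists C.
Qed.

Lemma conflict_free_to_AFRA (T : Type) (G : afra T) (hG : is_AF G)
    (U : set T) :
  conflict_free G (to_AFRA G U) <-> D_conflict_free (as_dung G) U.
Proof.
split=> [cfU [A [B [UA UB /= AB]]]|cfU [V [W [UV UW VW]]]]; apply: cfU.
  exists (Att (A, Arg B)), (Arg B); split.
  - by apply/to_AFRA_Att.
  - exact/to_AFRA_Arg.
  - by apply/defeats_Arg; exists A.
(* The defeated element may be taken to be an argument: an attack in [to_AFRA G U] has its source in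
   [U], and [V] defeats that source too. *)
have [B UB] : exists2 B, U B & defeats G V (Arg B).
  case: W UW VW => [B /to_AFRA_Arg UB VB|b /to_AFRA_Att[Gb Ub]]; first by exists B.
  by move=> /(defeats_Att hG _ Gb) VB; exists (src b).
move=> /defeats_Arg[A eV AB]; exists A, B; split=> //.
by move: UV; rewrite eV => /to_AFRA_Att[].
Qed.

Lemma complete_to_AFRA (T : Type) (G : afra T) (hG : is_AF G) (U : set T) :
  complete_extension G (to_AFRA G U) <->
  D_complete_extension (as_dung G) U.
Proof.
split=> [[[cfU accU] comU]|[[cfU accU] comU]].
  split; first split; first exact/conflict_free_to_AFRA.
    by move=> A UA; apply/acceptable_to_AFRA => //; apply/accU/to_AFRA_Arg.
  move=> A GA /(acceptable_to_AFRA hG) accA.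
  by apply/(to_AFRA_Arg G); apply: comU => //; apply/elements_Arg.
split; first split; first exact/conflict_free_to_AFRA.
  case=> [A /to_AFRA_Arg UA|b /to_AFRA_Att[Gb Ub]].
    by apply/acceptable_to_AFRA => //; apply: accU.
  by apply/acceptable_Att => //; apply/acceptable_to_AFRA => //; apply: accU.
case=> [A /elements_Arg GA /(acceptable_to_AFRA hG) accA|b /elements_Att Gb].
  by apply/to_AFRA_Arg; apply: comU.
move=> /(acceptable_Att hG _ Gb)/(acceptable_to_AFRA hG) accb.
by apply/to_AFRA_Att; split=> //; apply: comU => //; apply: src_args.
Qed.

(** An attack and its source are acceptable together, and a complete [S] contains exactly the
    acceptable elements; so an attack of [G] is in [S] iff its source is. *)
Lemma complete_extensionE (T : Type) (G : afra T) (hG : is_AF G)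
    (S : set (entity T)) (hS : S `<=` elements G) :
  complete_extension G S -> S = to_AFRA G [set A | S (Arg A)].
Proof.
move=> [[_ accS] comS]; apply/seteqP; split=> [] [A|b].
- by move=> SA; apply/to_AFRA_Arg.
- move=> Sb; have /elements_Att Gb := hS _ Sb.
  apply/to_AFRA_Att; split=> //=; apply: comS.
    exact/elements_Arg/src_args.
  exact/(acceptable_Att hG _ Gb)/accS.
- by move=> /to_AFRA_Arg.
- move=> /to_AFRA_Att[Gb Sb]; apply: comS; first exact/elements_Att.
  exact/(acceptable_Att hG _ Gb)/accS.
Qed.

Unset Implicit Arguments.
Set Strict Implicit.

Theorem proposition6 (T : Type) (G : afra T) (hG : is_AF G)
  (S : set (entity T)) (hS : S `<=` elements G) :
  complete_extension G S <->
  exists U : set T,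
    [/\ U `<=` args G, D_complete_extension (as_dung G) U & S = to_AFRA G U].
Proof.
split=> [comS|[U [_ comU ->]]]; last exact/complete_to_AFRA.
have eS := complete_extensionE hG hS comS.
exists [set A | S (Arg A)]; split=> //.
  by move=> A /hS/elements_Arg.
(* The chosen [U] consists of the arguments of [S], so [eS] turns the goal back into completeness of
   [S]. *)
by apply/complete_to_AFRA => //; rewrite -eS.
Qed.
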